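(* Let $\mathcal{X}=(M\xrightarrow{\partial}N,\cdot,\{-,-\})$ be a braided crossed module of Lie $K$-algebras. Then $\mathcal{X}$ has a universal compatible central extension if and only if it is perfect as a crossed module, i.e. $(M\xrightarrow{\partial}N,\cdot)$ is a perfect crossed module of Lie $K$-algebras.
   Context: $K$ is a fixed field; all Lie algebras and Lie homomorphisms are over $K$. A crossed module of Lie algebras $(M\xrightarrow{\partial}N,\cdot)$ consists of a Lie action of $N$ on $M$, i.e. a $K$-bilinear map $\cdot\colon N\times M\to M$ with $[n,n']\cdot m=n\cdot(n'\cdot m)-n'\cdot(n\cdot m)$ and $n\cdot[m,m']=[n\cdot m,m']+[m,n\cdot m']$, and a Lie homomorphism $\partial\colon M\to N$ with $\partial(n\cdot m)=[n,\partial(m)]$ and $\partial(m)\cdot m'=[m,m']$. A braiding on it is a $K$-bilinear map $\{-,-\}\colon N\times N\to M$ such that, for all $m,m'\in M$, $n,n',n''\in N$: $\partial\{n,n'\}=[n,n']$; $\{\partial m,\partial m'\}=[m,m']$; $\{\partial m,n\}=-n\cdot m$; $\{n,\partial m\}=n\cdot m$; $\{n,[n',n'']\}=\{[n,n'],n''\}-\{[n,n''],n'\}$; $\{[n,n'],n''\}=\{n,[n',n'']\}-\{n',[n,n'']\}$. Then $(M\xrightarrow{\partial}N,\cdot,\{-,-\})$ is a braided crossed module. A morphism of braided crossed modules from $(M\xrightarrow{\partial}N,\cdot,\{-,-\})$ to $(L\xrightarrow{\delta}H,*,\langle-,-\rangle)$ is a pair of Lie homomorphisms $f_1\colon M\to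 L$, $f_2\colon N\to H$ with $f_1(n\cdot m)=f_2(n)*f_1(m)$, $\delta\circ f_1=f_2\circ\partial$ and $f_1(\{n,n'\})=\langle f_2(n),f_2(n')\rangle$. Put $M^N=\{m\in M\mid n\cdot m=0\ \forall n\in N\}$, $\mathrm{st}_N(M)=\{n\in N\mid n\cdot m=0\ \forall m\in M\}$, $Z(N)$ the center of $N$, and $D_N(M)$ the Lie subalgebra of $M$ generated by all $n\cdot m$. The crossed module $(M\xrightarrow{\partial}N,\cdot)$ is perfect if $M=D_N(M)$ and $N=[N,N]$. An extension of braided crossed modules is a morphism $(f_1,f_2)$ with $f_1,f_2$ surjective; an extension with domain $(M\xrightarrow{\partial}N,\cdot,\{-,-\})$ is a compatible central extension if it is central as an extension of crossed modules, i.e. $\ker(f_1)\subset M^N$ and $\ker(f_2)\subset\mathrm{st}_N(M)\cap Z(N)$. A compatible central extension $u\colon\mathcal{U}\to\mathcal{X}$ is universal if for every compatible central extension $f\colon\mathcal{Z}\to\mathcal{X}$ there is a unique morphism of braided crossed modules $h\colon\mathcal{U}\to\mathcal{Z}$ with $u=f\circ h$. *)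

(* Defs.v *)
From HB Require Import structures.
From mathcomp Require Import all_boot all_order all_algebra.
From mathcomp Require Import boolp classical_sets.

Set Implicit Arguments.
Unset Strict Implicit.
Unset Printing Implicit Defensive.

Import GRing.Theory.
Local Open Scope classical_set_scope.
Local Open Scope ring_scope.

HB.mixin Record Lmodule_isLieAlgebra (K : fieldType) L of GRing.Lmodule K L := {
  lie : {bilinear L -> L -> L};
  liexx : forall x : L, lie x x = 0;
  lie_jacobi : forall x y z : L,
    lie x (lie y z) + lie y (lie z x) + lie z (lie x y) = 0
}.

#[short(type="lieAlgType")]
HB.structure Definition LieAlgebra (K : fieldType) :=
  { L of GRing.Lmodule K L & Lmodule_isLieAlgebra K L }.

Notation "⁅ x , y ⁆" := (lie x y)
  (at level 0, x at level 99, y at level 99, format "⁅ x ,  y ⁆") : ring_scope.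

HB.mixin Record isLieMorphism (K : fieldType) (L L' : lieAlgType K)
    (f : L -> L') := {
  lie_morph : {morph f : x y / ⁅x, y⁆ >-> ⁅x, y⁆}
}.

#[short(type="lieMorphism")]
HB.structure Definition LieMorphism (K : fieldType) (L L' : lieAlgType K) :=
  { f of @GRing.Linear K L L' *:%R f & isLieMorphism K L L' f }.

Notation "{ 'lie' L -> L' }" := (lieMorphism L%type L'%type)
  (at level 0, L at level 98, L' at level 99,
   format "{ 'lie'  L  ->  L' }") : type_scope.

Lemma comp_lie_morph (K : fieldType) (L1 L2 L3 : lieAlgType K)
    (g : {lie L2 -> L3}) (f : {lie L1 -> L2}) :
  {morph g \o f : x y / ⁅x, y⁆ >-> ⁅x, y⁆}.
Proof. by move=> x y /=; rewrite !lie_morph. Qed.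

HB.instance Definition _ (K : fieldType) (L1 L2 L3 : lieAlgType K)
    (g : {lie L2 -> L3}) (f : {lie L1 -> L2}) :=
  isLieMorphism.Build K L1 L3 (g \o f) (comp_lie_morph g f).

Definition lie_center (K : fieldType) (L : lieAlgType K) : set L :=
  [set x | forall y, ⁅x, y⁆ = 0].

Arguments lie_center {K} L _.

Definition lie_subalgebra (K : fieldType) (L : lieAlgType K) (S : set L) :=
  submod_closed [in S] /\ {in S &, forall x y, ⁅x, y⁆ \in S}.

Definition generated_lie_subalgebra (K : fieldType) (L : lieAlgType K)
    (G : set L) : set L :=
  smallest (@lie_subalgebra K L) G.

(* ⁅L, L⁆, the K-linear span of all brackets *)
Definition derived_algebra (K : fieldType) (L : lieAlgType K) : set L :=
  smallest (fun S : set L => submod_closed [in S])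
           [set ⁅x, y⁆ | x in [set: L] & y in [set: L]].

Arguments derived_algebra {K} L _.

Definition kernel (K : fieldType) (L L' : lieAlgType K)
    (f : {lie L -> L'}) : set L :=
  f @^-1` [set 0].

Definition lie_surjective (K : fieldType) (L L' : lieAlgType K)
    (f : {lie L -> L'}) : Prop :=
  range f = [set: L'].

Record crossedModule (K : fieldType) := CrossedModule {
  xM : lieAlgType K;
  xN : lieAlgType K;
  xact : {bilinear xN -> xM -> xM};
  xbd : {lie xM -> xN};
  xact_lie : forall (n n' : xN) (m : xM),
    xact ⁅n, n'⁆ m = xact n (xact n' m) - xact n' (xact n m);
  xact_der : forall (n : xN) (m m' : xM),
    xact n ⁅m, m'⁆ = ⁅xact n m, m'⁆ + ⁅m, xact n m'⁆;
  xbd_act : forall (n : xN) (m : xM), xbd (xact n m) = ⁅n, xbd m⁆;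
  xpeiffer : forall m m' : xM, xact (xbd m) m' = ⁅m, m'⁆
}.

Arguments xact {K c}.
Arguments xbd {K c}.

(* M^N *)
Definition act_invariants (K : fieldType) (X : crossedModule K) : set (xM X) :=
  [set m | forall n : xN X, xact n m = 0].

(* st_N(M) *)
Definition act_stabilizer (K : fieldType) (X : crossedModule K) : set (xN X) :=
  [set n | forall m : xM X, xact n m = 0].

(* D_N(M) *)
Definition act_derived (K : fieldType) (X : crossedModule K) : set (xM X) :=
  generated_lie_subalgebra
    [set xact n m | n in [set: xN X] & m in [set: xM X]].

Arguments act_invariants {K} X _.
Arguments act_stabilizer {K} X _.
Arguments act_derived {K} X _.

Definition perfect (K : fieldType) (X : crossedModule K) : Prop :=
  act_derived X = [set: xM X] /\ derived_algebra (xN X) = [set: xN X].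

Record xmodHom (K : fieldType) (X Y : crossedModule K) := XModHom {
  hom1 : {lie xM X -> xM Y};
  hom2 : {lie xN X -> xN Y};
  hom_act : forall (n : xN X) (m : xM X),
    hom1 (xact n m) = xact (hom2 n) (hom1 m);
  hom_bd : forall m : xM X, xbd (hom1 m) = hom2 (xbd m)
}.

Definition xmod_extension (K : fieldType) (X Y : crossedModule K)
    (f : xmodHom X Y) : Prop :=
  lie_surjective (hom1 f) /\ lie_surjective (hom2 f).

Definition xmod_central_extension (K : fieldType) (X Y : crossedModule K)
    (f : xmodHom X Y) : Prop :=
  [/\ xmod_extension f,
      kernel (hom1 f) `<=` act_invariants X &
      kernel (hom2 f) `<=` act_stabilizer X `&` lie_center (xN X)].

Record braidedCrossedModule (K : fieldType) := BraidedCrossedModule {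
  bxmod :> crossedModule K;
  braid : {bilinear xN bxmod -> xN bxmod -> xM bxmod};
  bd_braid : forall n n' : xN bxmod, xbd (braid n n') = ⁅n, n'⁆;
  braid_bd : forall m m' : xM bxmod,
    braid (xbd m) (xbd m') = ⁅m, m'⁆;
  braid_bdl : forall (m : xM bxmod) (n : xN bxmod),
    braid (xbd m) n = - xact n m;
  braid_bdr : forall (n : xN bxmod) (m : xM bxmod),
    braid n (xbd m) = xact n m;
  braid_lier : forall n n' n'' : xN bxmod,
    braid n ⁅n', n''⁆ = braid ⁅n, n'⁆ n'' - braid ⁅n, n''⁆ n';
  braid_liel : forall n n' n'' : xN bxmod,
    braid ⁅n, n'⁆ n'' = braid n ⁅n', n''⁆ - braid n' ⁅n, n''⁆
}.

Arguments braid {K b}.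

Record bxmodHom (K : fieldType) (X Y : braidedCrossedModule K) := BXModHom {
  bhom :> xmodHom X Y;
  hom_braid : forall n n' : xN X,
    hom1 bhom (braid n n') = braid (hom2 bhom n) (hom2 bhom n')
}.

(* A morphism is determined by its pair of maps; the remaining fields of
   bxmodHom are proofs. *)
Definition bxmodHom_eq (K : fieldType) (X Y : braidedCrossedModule K)
    (f g : bxmodHom X Y) : Prop :=
  hom1 f =1 hom1 g /\ hom2 f =1 hom2 g.

Definition xmod_comp (K : fieldType) (X Y Z : crossedModule K)
    (g : xmodHom Y Z) (f : xmodHom X Y) : xmodHom X Z.
Proof.
refine (@XModHom K X Z (hom1 g \o hom1 f) (hom2 g \o hom2 f) _ _).
- by move=> n m /=; rewrite !hom_act.
- by move=> m /=; rewrite !hom_bd.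
Defined.

Definition bxmod_comp (K : fieldType) (X Y Z : braidedCrossedModule K)
    (g : bxmodHom Y Z) (f : bxmodHom X Y) : bxmodHom X Z.
Proof.
refine (@BXModHom K X Z (xmod_comp g f) _).
by move=> n n' /=; rewrite !hom_braid.
Defined.

Definition compatible_central_extension (K : fieldType)
    (X Y : braidedCrossedModule K) (f : bxmodHom X Y) : Prop :=
  xmod_central_extension f.

Definition universal_compatible_central_extension (K : fieldType)
    (U X : braidedCrossedModule K) (u : bxmodHom U X) : Prop :=
  compatible_central_extension u /\
  forall (Z : braidedCrossedModule K) (f : bxmodHom Z X),
    compatible_central_extension f ->
    exists h : bxmodHom U Z,
      bxmodHom_eq u (bxmod_comp f h) /\
      forall h' : bxmodHom U Z,
        bxmodHom_eq u (bxmod_comp f h') -> bxmodHom_eq h h'.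

(* Main.v *)
Require Import Defs.
From HB Require Import structures.
From mathcomp Require Import all_boot all_order all_algebra.
From mathcomp Require Import boolp classical_sets freeg.

(* If X is perfect, then N is perfect and bd : M -> N is a central extension
   of N by a perfect Lie algebra.  With W the universal central extension of N
   and u1 : W -> M its comparison map, (W =id=> W), braided by the bracket, maps
   to X by (u1, bd \o u1), and this extension is universal: for a compatible
   central extension f from Z the map bd \o f1 from xM Z to N need not be
   central, but elements of its kernel commute with the derived algebra of
   xM Z, which is enough to lift W to xM Z.

   Conversely, universality forbids nonzero morphisms from X to an abelian
   module (A -> A): the graph of one and the zero section would give two lifts
   to the trivial extension X x A.  Applied to A = N / [N, N] with the identity
   boundary, and then to A = M / D_N(M) with the zero boundary, this gives
   perfectness. *)

Set Implicit Arguments.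
Unset Strict Implicit.
Unset Printing Implicit Defensive.

Import GRing.Theory.
Local Open Scope classical_set_scope.
Local Open Scope quotient_scope.
Local Open Scope ring_scope.

(** * Linear spans and quotient modules *)

Lemma smallest_submod_closed (K : fieldType) (V : lmodType K) (G : set V) :
  submod_closed [in smallest (fun S : set V => submod_closed [in S]) G].
Proof.
split=> [|a u v /set_mem uS /set_mem vS]; apply/mem_set => S [Scl GS].
  exact/set_mem/Scl.1.
by apply/set_mem/Scl.2; apply/mem_set; [apply: uS|apply: vS].
Qed.

Lemma submod_closed_set (K : fieldType) (V : lmodType K) (S : set V) :
  submod_closed [in S] <->
  (S 0 /\ forall a u v, S u -> S v -> S (a *: u + v)).
Proof.
split=> [[/set_mem S0 SD]|[S0 SD]]; split=> //.
- by move=> a u v /mem_set uS /mem_set vS; apply/set_mem/SD.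
- exact/mem_set.
- by move=> a u v /set_mem uS /set_mem vS; apply/mem_set/SD.
Qed.

Section QuotientModule.
Variables (K : fieldType) (V : lmodType K) (S : set V).
Hypothesis S_submod : submod_closed [in S].

Definition submod_pred : {pred V} := [in S].

HB.instance Definition _ :=
  GRing.isZmodClosed.Build V submod_pred (GRing.submod_closedB S_submod).

Definition quotmod := Quotient.quot submod_pred.

HB.instance Definition _ := GRing.Zmodule.on quotmod.

Definition quotmod_pi (x : V) : quotmod := \pi_quotmod x.

Lemma quotmod_eq x y : (quotmod_pi x = quotmod_pi y) <-> S (x - y).
Proof.
split=> [/eqP|Sxy]; first by rewrite -Quotient.idealrBE => /set_mem.
by apply/eqP; rewrite -Quotient.idealrBE; apply/mem_set.
Qed.

Definition quotmod_repr (q : quotmod) : V := repr q.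

Lemma quotmod_reprK : cancel quotmod_repr quotmod_pi.
Proof. by move=> q; exact: reprK. Qed.

Lemma quotmod_repr_pi x : S (quotmod_repr (quotmod_pi x) - x).
Proof. by apply/quotmod_eq; rewrite quotmod_reprK. Qed.

(** Scalars act through the chosen representative; [quotmod_piZ] shows that the choice does not
    matter. *)
Definition quotmod_scale (a : K) (q : quotmod) : quotmod :=
  quotmod_pi (a *: quotmod_repr q).

Lemma quotmod_piZ a x : quotmod_scale a (quotmod_pi x) = quotmod_pi (a *: x).
Proof. apply/quotmod_eq; rewrite -scalerBr -[_ *: _]addr0.
have [S0 SD] := (submod_closed_set S).1 S_submod.
by apply: SD => //; apply: quotmod_repr_pi. Qed.

Let piD x y : quotmod_pi (x + y) = quotmod_pi x + quotmod_pi y.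
Proof. exact: (@raddfD _ _ (\pi_quotmod)). Qed.

Fact quotmod_scaleA a b q :
  quotmod_scale a (quotmod_scale b q) = quotmod_scale (a * b) q.
Proof. by rewrite [X in _ a X]/quotmod_scale quotmod_piZ scalerA. Qed.

Fact quotmod_scale1 : left_id 1 quotmod_scale.
Proof. by move=> q; rewrite /quotmod_scale scale1r quotmod_reprK. Qed.

Fact quotmod_scaleDr : right_distributive quotmod_scale +%R.
Proof.
move=> a p q; rewrite -[p]quotmod_reprK -[q]quotmod_reprK.
by rewrite -piD !quotmod_piZ scalerDr piD.
Qed.

Fact quotmod_scaleDl q : {morph quotmod_scale^~ q : a b / a + b}.
Proof. by move=> a b; rewrite /quotmod_scale scalerDl piD. Qed.

HB.instance Definition _ := GRing.Zmodule_isLmodule.Build K quotmod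
  quotmod_scaleA quotmod_scale1 quotmod_scaleDr quotmod_scaleDl.

Fact quotmod_pi_linear : linear quotmod_pi.
Proof. by move=> a x y; rewrite piD -quotmod_piZ. Qed.

HB.instance Definition _ :=
  GRing.isLinear.Build K V quotmod *:%R quotmod_pi quotmod_pi_linear.

Lemma quotmod_pi_eq0 x : (quotmod_pi x = 0) <-> S x.
Proof. by rewrite -(linear0 quotmod_pi) quotmod_eq subr0. Qed.

End QuotientModule.

(** * Linear maps out of a free module *)

Section FreeModuleLift.
Variables (K : nzRingType) (T : choiceType) (E : lmodType K) (f : T -> E).

(** Additivity is [lift_is_additive]; compatibility with scalars is checked on the expansion of [u]
    into scaled generators. *)
Lemma fglift_linear : linear (fglift f : {freeg T / K} -> E).
Proof.
pose F := GRing.isZmodMorphism.Build {freeg T / K} E (fglift f)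
  (lift_is_additive f).
pose g : {additive {freeg T / K} -> E} := HB.pack (fglift f) F.
have gU a x : g << a *g x >> = a *: f x by exact: liftU.
move=> a u v; rewrite -![fglift f _]/(g _) raddfD; congr (_ + _).
rewrite -[in RHS](freeg_sumE u) !(raddf_sum g) scaler_sumr.
by apply: eq_bigr => x _; rewrite !gU scalerA.
Qed.

End FreeModuleLift.

Lemma freeg_span (K : nzRingType) (T : choiceType) (P : {freeg T / K} -> Prop) :
  P 0 -> (forall a u v, P u -> P v -> P (a *: u + v)) ->
  (forall x, P << x >>) -> forall u, P u.
Proof.
move=> P0 PD PU u; rewrite -(freeg_sumE u).
elim: (dom u) => [|x s IHs]; first by rewrite big_nil.
rewrite big_cons; set r := \sum_(_ <- s) _ in IHs *.
have -> : << coeff x u *g x >> = coeff x u *: << x >> :> {freeg T / K}.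
  by apply/eqP/freeg_eqP => y; rewrite coeffZ !coeffU mul1r.
exact: PD.
Qed.

(** * 2-cocycles with trivial coefficients and the universal central extension *)

Record cocycle2 (K : fieldType) (N : lieAlgType K) (E : lmodType K)
    (b : N -> N -> E) : Prop := Cocycle2 {
  cocycle2_bilinear : bilinear_for *:%R *:%R b;
  cocycle2_xx : forall x, b x x = 0;
  cocycle2_jacobi : forall x y z,
    b x ⁅y, z⁆ + b y ⁅z, x⁆ + b z ⁅x, y⁆ = 0
}.

Section UniversalCentralExtension.
Variables (K : fieldType) (N : lieAlgType K).

Local Notation free := {freeg (N * N) / K}.

Definition free_gen (x y : N) : free := << (x, y) >>.

Variant uce_relator : set free :=
| RelLinearl a x x' y :
    uce_relator (free_gen (a *: x + x') y - (a *: free_gen x y + free_gen x' y))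
| RelLinearr a x y y' :
    uce_relator (free_gen x (a *: y + y') - (a *: free_gen x y + free_gen x y'))
| RelAlternating x : uce_relator (free_gen x x)
| RelJacobi x y z :
    uce_relator (free_gen x ⁅y, z⁆ + free_gen y ⁅z, x⁆ + free_gen z ⁅x, y⁆).

(** The exterior square of [N] modulo the image of the Chevalley-Eilenberg differential from degree
    three. It is the target of the universal 2-cocycle [wedge], and for perfect [N] it is the
    universal central extension of [N]. *)
Definition uce := quotmod (smallest_submod_closed uce_relator).

HB.instance Definition _ := GRing.Lmodule.on uce.

Definition uce_pi : {linear free -> uce} :=
  quotmod_pi (smallest_submod_closed uce_relator).

Definition wedge (x y : N) : uce := uce_pi (free_gen x y).

Lemma uce_pi_relator r : uce_relator r -> uce_pi r = 0.
Proof.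
by move=> Rr; apply/quotmod_pi_eq0; apply: sub_gen_smallest.
Qed.

Lemma wedge_cocycle2 : cocycle2 wedge.
Proof.
split=> [|x|x y z].
- split=> [y a x x'|x a y y']; apply/eqP; rewrite -subr_eq0 /wedge; apply/eqP.
  + by rewrite -linearP -linearB; apply/uce_pi_relator/RelLinearl.
  + by rewrite -linearP -linearB; apply/uce_pi_relator/RelLinearr.
- exact/uce_pi_relator/RelAlternating.
- by rewrite /wedge -!linearD; apply/uce_pi_relator/RelJacobi.
Qed.

Lemma uce_span (P : uce -> Prop) :
  P 0 -> (forall a u v, P u -> P v -> P (a *: u + v)) ->
  (forall x y, P (wedge x y)) -> forall w, P w.
Proof.
move=> P0 PD PW w; rewrite -(quotmod_reprK w).
move: (quotmod_repr w); apply: freeg_span => [|a u v Pu Pv|[x y]].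
- by rewrite linear0.
- by rewrite linearP; apply: PD.
- exact: PW.
Qed.

Section Lift.
Variables (E : lmodType K) (b : N -> N -> E) (b_cocycle : cocycle2 b).

Definition free_lift (u : free) : E := fglift (fun p => b p.1 p.2) u.

(** Evaluated on an arbitrary representative. For a cocycle [b] this is the map induced by
    [free_lift], because [b] then kills all relators ([free_lift_relations]). *)
Definition uce_lift (w : uce) : E := free_lift (quotmod_repr w).

HB.instance Definition _ := GRing.isLinear.Build K free E *:%R free_lift
  (fglift_linear (fun p => b p.1 p.2)).

Lemma free_lift_gen x y : free_lift (free_gen x y) = b x y.
Proof. by rewrite [LHS]liftU scale1r. Qed.

Lemma free_lift_relations u :
  smallest (fun S : set free => submod_closed [in S]) uce_relator u ->
  free_lift u = 0.
Proof.
have [bl bxx bJ] := b_cocycle.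
move=> /(_ [set u | free_lift u = 0]); apply; split.
  apply/submod_closed_set; split=> [|a v v' /= v0 v'0]; first exact: linear0.
  by rewrite linearP /= v0 v'0 scaler0 addr0.
move=> _ [a x x' y|a x y y'|x|x y z] /=.
- by rewrite linearB linearP /= !free_lift_gen bl.1 subrr.
- by rewrite linearB linearP /= !free_lift_gen bl.2 subrr.
- by rewrite free_lift_gen.
- by rewrite !linearD /= !free_lift_gen.
Qed.

Lemma uce_lift_pi u : uce_lift (uce_pi u) = free_lift u.
Proof.
apply/eqP; rewrite -subr_eq0 -linearB; apply/eqP/free_lift_relations.
exact: quotmod_repr_pi.
Qed.

Lemma uce_lift_wedge x y : uce_lift (wedge x y) = b x y.
Proof. by rewrite uce_lift_pi free_lift_gen. Qed.

Lemma uce_lift_linear : linear uce_lift.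
Proof.
move=> a u v; rewrite -[u]quotmod_reprK -[v]quotmod_reprK -!/(uce_pi _).
by rewrite -linearP !uce_lift_pi linearP.
Qed.

End Lift.

Lemma lie_cocycle2 : cocycle2 (fun x y : N => ⁅x, y⁆).
Proof.
split; [|exact: liexx|exact: lie_jacobi].
by split=> [y a x x'|x a y y']; rewrite ?linearPl ?linearPr.
Qed.

Definition uce_map : uce -> N := uce_lift (fun x y => ⁅x, y⁆).

HB.instance Definition _ := GRing.isLinear.Build K uce N *:%R uce_map
  (uce_lift_linear lie_cocycle2).

Lemma uce_map_wedge x y : uce_map (wedge x y) = ⁅x, y⁆.
Proof. exact: uce_lift_wedge lie_cocycle2 x y. Qed.

(** The bracket sees its arguments only through their images in [N]. Hence the kernel of [uce_map]
    is central, and the Jacobi identity is the cocycle identity for [wedge]. *)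
Definition uce_lie (w w' : uce) : uce := wedge (uce_map w) (uce_map w').

Fact uce_lie_bilinear : bilinear_for *:%R *:%R uce_lie.
Proof.
have [bl _ _] := wedge_cocycle2.
by split=> [y a x x'|x a y y']; rewrite /uce_lie linearP ?bl.1 ?bl.2.
Qed.

HB.instance Definition _ :=
  bilinear_isBilinear.Build K uce uce uce *:%R *:%R uce_lie uce_lie_bilinear.

Fact uce_liexx w : uce_lie w w = 0.
Proof. exact: cocycle2_xx wedge_cocycle2 _. Qed.

Fact uce_lie_jacobi u v w :
  uce_lie u (uce_lie v w) + uce_lie v (uce_lie w u) + uce_lie w (uce_lie u v)
  = 0.
Proof.
by rewrite /uce_lie !uce_map_wedge; apply: cocycle2_jacobi wedge_cocycle2 _ _ _.
Qed.

HB.instance Definition _ := Lmodule_isLieAlgebra.Build K uce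
  uce_liexx uce_lie_jacobi.

Lemma uce_lieE (w w' : uce) : ⁅w, w'⁆ = wedge (uce_map w) (uce_map w').
Proof. by []. Qed.

Fact uce_map_lie : {morph uce_map : w w' / ⁅w, w'⁆ >-> ⁅w, w'⁆}.
Proof. by move=> w w'; rewrite uce_lieE uce_map_wedge. Qed.

HB.instance Definition _ := isLieMorphism.Build K uce N uce_map uce_map_lie.

Lemma kernel_uce_map_center : kernel uce_map `<=` lie_center uce.
Proof.
move=> w w0 w'; rewrite uce_lieE [uce_map w]w0 -(linear0 uce_map) -uce_lieE.
exact: linear0l.
Qed.

End UniversalCentralExtension.

(** * Brackets, derived algebras and generated subalgebras *)

Section LieAlgebraTheory.
Variables (K : fieldType) (L : lieAlgType K).

Lemma lieC (x y : L) : ⁅x, y⁆ = - ⁅y, x⁆.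
Proof.
apply/eqP; rewrite -addr_eq0 -[X in _ == X](liexx (x + y)).
by rewrite linearDl /= !linearDr /= !liexx addr0 add0r.
Qed.

Lemma lie_derivation (x y z : L) : ⁅x, ⁅y, z⁆⁆ = ⁅⁅x, y⁆, z⁆ + ⁅y, ⁅x, z⁆⁆.
Proof.
apply/eqP; rewrite -subr_eq0 opprD addrA -(lie_jacobi x y z).
by rewrite (lieC ⁅x, y⁆) opprK (lieC x z) linearNr opprK addrAC.
Qed.

Lemma derived_lie (x y : L) : derived_algebra L ⁅x, y⁆.
Proof. by apply: sub_gen_smallest; exists x => //; exists y. Qed.

Lemma perfect_ind (P : L -> Prop) :
  derived_algebra L = [set: L] ->
  P 0 -> (forall a x y, P x -> P y -> P (a *: x + y)) ->
  (forall x y, P ⁅x, y⁆) -> forall x, P x.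
Proof.
move=> dL P0 PD PL x; have : derived_algebra L x by rewrite dL.
move/(_ P); apply; split; first exact/submod_closed_set.
by move=> _ [y _ [z _ <-]]; exact: PL.
Qed.

Lemma generated_lie_subalgebra_closed (G : set L) :
  lie_subalgebra (generated_lie_subalgebra G).
Proof.
split=> [|x y /set_mem xG /set_mem yG].
  apply/submod_closed_set; split=> [S [[/submod_closed_set[]]]|] //.
  move=> a x y xG yG S SP; have [[/submod_closed_set[_ SD] _] _] := SP.
  by apply: SD; [apply: xG|apply: yG].
apply/mem_set => S SP; have [[_ SL] _] := SP.
by apply/set_mem/SL; apply/mem_set; [apply: xG|apply: yG].
Qed.

End LieAlgebraTheory.

HB.instance Definition _ (K : fieldType) (L : lieAlgType K) :=
  isLieMorphism.Build K L L idfun (fun _ _ => erefl).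

(** * Homomorphisms with central kernel *)

Section CentralKernel.
Variables (K : fieldType) (E N : lieAlgType K) (p : {lie E -> N}).
Hypothesis p_central : kernel p `<=` lie_center E.

(** The arguments are replaced one at a time; each replacement changes the bracket by a bracket with
    an element of the central kernel. *)
Lemma lie_central_congr (x x' y y' : E) :
  p x = p x' -> p y = p y' -> ⁅x, y⁆ = ⁅x', y'⁆.
Proof.
have congrl (a a' b : E) : p a = p a' -> ⁅a, b⁆ = ⁅a', b⁆.
  move=> paa'; apply/eqP; rewrite -subr_eq0 -linearBl /=; apply/eqP.
  by apply: p_central; rewrite /kernel /= linearB /= paa' subrr.
by move=> pxx' pyy'; rewrite (congrl _ x') // lieC (congrl _ y') // -lieC.
Qed.

(** Brackets in [E] depend only on images under [p], so both maps agree on brackets, and these span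
    [W]. *)
Lemma perfect_hom_unique (W : lieAlgType K) (phi psi : {lie W -> E}) :
  derived_algebra W = [set: W] ->
  (forall w, p (phi w) = p (psi w)) -> phi =1 psi.
Proof.
move=> dW pE; apply: (perfect_ind dW) => [|a x y|x y]; rewrite ?linear0 //.
  by rewrite !linearP /= => -> ->.
by rewrite !lie_morph; apply: lie_central_congr.
Qed.

(** A bracket in [E] is unchanged when its arguments are replaced by elements [phi v] and [phi w]
    with the same images under [p], so it is [phi ⁅v, w⁆]; brackets span [E]. *)
Lemma perfect_hom_surjective (W : lieAlgType K) (phi : {lie W -> E}) :
  derived_algebra E = [set: E] ->
  (forall n, exists w, p (phi w) = n) -> forall x, exists w, phi w = x.
Proof.
move=> dE p_surj; apply: (perfect_ind dE).
- by exists 0; rewrite linear0.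
- by move=> a _ _ [x <-] [y <-]; exists (a *: x + y); rewrite linearP.
- move=> x y; have [[v pv] [w pw]] := (p_surj (p x), p_surj (p y)).
  by exists ⁅v, w⁆; rewrite lie_morph; apply: lie_central_congr.
Qed.

End CentralKernel.

(** * The universal central extension of a perfect Lie algebra *)

Section PerfectUce.
Variables (K : fieldType) (N : lieAlgType K).
Hypothesis N_perfect : derived_algebra N = [set: N].

Lemma uce_map_surjective (x : N) : exists w, uce_map w = x.
Proof.
move: x; apply: (perfect_ind N_perfect) => [|a _ _ [x <-] [y <-]|x y].
- by exists 0; rewrite linear0.
- by exists (a *: x + y); rewrite linearP.
- by exists (wedge x y); rewrite uce_map_wedge.
Qed.

(** Each generator [wedge x y] is the bracket of any preimages of [x] and [y] under [uce_map]. *)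
Lemma uce_perfect : derived_algebra (uce N) = [set: uce N].
Proof.
apply/seteqP; split=> // w _.
have [d0 dD] := (submod_closed_set _).1 (smallest_submod_closed
  [set ⁅x, y⁆ | x in [set: uce N] & y in [set: uce N]]).
move: w; apply: uce_span =>// x y.
have [[v <-] [w <-]] := (uce_map_surjective x, uce_map_surjective y).
exact: derived_lie.
Qed.

End PerfectUce.

(* The bracket of lifts of x and y to D depends on x and y alone, so it
   is a 2-cocycle on N; only brackets against D need to kill ker g, which
   is weaker than centrality of g. *)
Lemma uce_lift_hom (K : fieldType) (N E : lieAlgType K) (g : {lie E -> N})
    (D : set E) :
  lie_subalgebra D ->
  (forall x, exists2 d, D d & g d = x) ->
  (forall d e, g d = 0 -> D e -> ⁅d, e⁆ = 0) ->
  exists h : {lie uce N -> E}, forall w, g (h w) = uce_map w.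
Proof.
move=> [/submod_closed_set[D0 DD] DL] g_surj D_central.
have {g_surj}/choice[s sP] : forall x, exists d, D d /\ g d = x.
  by move=> x; have [d] := g_surj x; exists d.
have Ds x : D (s x) by case: (sP x).
have gs x : g (s x) = x by case: (sP x).
have congrl d d' e : D e -> g d = g d' -> ⁅d, e⁆ = ⁅d', e⁆.
  move=> De gdd'; apply/eqP; rewrite -subr_eq0 -linearBl /=; apply/eqP.
  by apply: D_central; rewrite // linearB /= gdd' subrr.
have congrr d e e' : D d -> g e = g e' -> ⁅d, e⁆ = ⁅d, e'⁆.
  by move=> Dd gee'; rewrite lieC (congrl _ e') // -lieC.
pose b x y := ⁅s x, s y⁆.
have bC : cocycle2 b.
  split=> [|x|x y z]; last 2 first.
  - exact: liexx.
  (* [s ⁅y, z⁆] and [⁅s y, s z⁆] have the same image under [g], so the cocycle identity is the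
     Jacobi identity in [E]. *)
  - rewrite -(lie_jacobi (s x) (s y) (s z)) /b.
    by congr (_ + _ + _); apply: congrr; rewrite // gs lie_morph !gs.
  split=> [y a x x'|x a y y'] /=; rewrite /b.
  - by rewrite -linearPl; apply: congrl; rewrite // linearP /= !gs.
  - by rewrite -linearPr; apply: congrr; rewrite // linearP /= !gs.
pose hlin := GRing.isLinear.Build K (uce N) E *:%R (uce_lift b)
  (uce_lift_linear bC).
pose h : {linear uce N -> E} := HB.pack (uce_lift b) hlin.
have hE x y : h (wedge x y) = ⁅s x, s y⁆ by exact: uce_lift_wedge.
(* Needed for [h_lie]: its second replacement keeps [h v] as left argument, and [congrr] requires
   that argument to lie in [D]. *)
have Dh w : D (h w).
  elim/uce_span: w => [|a u v Du Dv|x y]; rewrite ?linear0 ?linearP //.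
    exact: DD.
  by rewrite hE; apply/set_mem/DL; apply/mem_set.
have gh w : g (h w) = uce_map w.
  elim/uce_span: w => [|a u v|x y]; rewrite ?linear0 //.
    by rewrite !linearP /= => -> ->.
  by rewrite hE lie_morph !gs uce_map_wedge.
have h_lie : {morph h : v w / ⁅v, w⁆ >-> ⁅v, w⁆}.
  move=> v w; rewrite uce_lieE hE.
  by rewrite (congrl _ (h v)) ?gs ?gh // (congrr _ _ (h w)) ?gs ?gh.
pose hl := isLieMorphism.Build K (uce N) E h h_lie.
by exists (HB.pack_for {lie uce N -> E} (uce_lift b) hlin hl).
Qed.

(** * Crossed modules with identity boundary and the morphisms out of them *)

Section IdentityCrossedModule.
Variables (K : fieldType) (L : lieAlgType K).

Definition id_xmod : crossedModule K.
Proof.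
refine (@CrossedModule K L L lie idfun _ _ _ _) => //.
- by move=> x y m; rewrite (lie_derivation x) addrK.
- by move=> x y z; apply: lie_derivation.
Defined.

Definition id_bxmod : braidedCrossedModule K.
Proof.
refine (@BraidedCrossedModule K id_xmod lie _ _ _ _ _ _) => //=.
- by move=> x y; apply: lieC.
- by move=> x y z; rewrite lie_derivation [X in _ + X]lieC.
- by move=> x y z; rewrite (lie_derivation x) addrK.
Defined.

Variables (Z : braidedCrossedModule K) (h : {lie L -> xM Z}).

(** As the boundary of [id_xmod] is the identity, [hom_bd] forces the second component to be
    [xbd \o h]. Morphisms out of [id_bxmod] thus amount to Lie homomorphisms into [xM Z]. *)
Definition id_xmod_hom : xmodHom id_xmod Z.
Proof.
refine (@XModHom K id_xmod Z h (xbd \o h) _ _) => //=.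
by move=> x y; rewrite lie_morph xpeiffer.
Defined.

Definition id_bxmod_hom : bxmodHom id_bxmod Z.
Proof.
refine (@BXModHom K id_bxmod Z id_xmod_hom _) => /=.
by move=> x y; rewrite lie_morph braid_bd.
Defined.

End IdentityCrossedModule.

(** * Centrality from the Peiffer identity *)

Section CrossedModuleTheory.
Variables (K : fieldType) (X : crossedModule K).

Lemma act_invariants_center : act_invariants X `<=` lie_center (xM X).
Proof. by move=> m mX y; rewrite lieC -xpeiffer mX oppr0. Qed.

Lemma kernel_xbd_center : kernel (@xbd K X) `<=` lie_center (xM X).
Proof. by move=> m /= bd0 y; rewrite -xpeiffer bd0 linear0l. Qed.

End CrossedModuleTheory.

(** * Perfectness gives a universal extension *)

Section PerfectBraided.
Variables (K : fieldType) (X : braidedCrossedModule K).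

(** The braiding exhibits every bracket in [xN X] as a boundary, and brackets span [xN X]. *)
Lemma braided_xbd_surjective :
  derived_algebra (xN X) = [set: xN X] ->
  forall n : xN X, exists m : xM X, xbd m = n.
Proof.
move=> dN; apply: (perfect_ind dN) => [|a _ _ [m <-] [m' <-]|x y].
- by exists 0; rewrite linear0.
- by exists (a *: m + m'); rewrite linearP.
- by exists (braid x y); rewrite bd_braid.
Qed.

Hypothesis X_perfect : perfect X.

(** Every [n] is a boundary, so by the Peiffer identity every [xact n m] is a bracket in [xM X]. The
    derived algebra is therefore a Lie subalgebra containing the generators of [act_derived X]. *)
Lemma perfect_xM_derived : derived_algebra (xM X) = [set: xM X].
Proof.
have [dM dN] := X_perfect; apply/seteqP; split=> // m _.
have : act_derived X m by rewrite dM.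
apply; split; first split.
- exact: smallest_submod_closed.
- by move=> x y _ _; apply: mem_set; apply: derived_lie.
- move=> _ [n _ [m' _ <-]].
  have [m0 <-] := braided_xbd_surjective dN n.
  by rewrite xpeiffer; apply: derived_lie.
Qed.

Lemma perfect_has_universal_compatible_central_extension :
  exists (U : braidedCrossedModule K) (u : bxmodHom U X),
    universal_compatible_central_extension u.
Proof.
have [_ dN] := X_perfect; have dM := perfect_xM_derived.
have bd_surj := braided_xbd_surjective dN.
have dW := uce_perfect dN.
(* The kernel of [xbd] is central, so all of [xM X] can serve as [D]. *)
have [|x|d e /= d0 _|u1 u1E] := @uce_lift_hom _ _ _ (@xbd K X) [set: xM X].
- split; last by move=> *; apply/mem_set.
  exact/submod_closed_set.
- by have [m <-] := bd_surj x; exists m.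
- exact: kernel_xbd_center d0 e.
have u1_surj : forall m, exists w, u1 w = m.
  apply: (perfect_hom_surjective (@kernel_xbd_center _ X) dM) => n.
  by have [w <-] := uce_map_surjective dN n; exists w.
exists (id_bxmod (uce (xN X))), (id_bxmod_hom u1); split; first split.
- split; apply/seteqP; split=> // x _ /=.
    by have [w <-] := u1_surj x; exists w.
  have [m <-] := bd_surj x; have [w <-] := u1_surj m.
  by exists w.
(* By [u1E] both kernels lie in the kernel of [uce_map], which is central; the action of [id_xmod]
   is the bracket, so central elements are invariant and act trivially. *)
- move=> w; rewrite /kernel /= => w0 n.
  by rewrite /= lieC kernel_uce_map_center ?oppr0 // /kernel /= -u1E w0 linear0.
- move=> w; rewrite /kernel /= u1E => w0.
  by split=> w' /=; apply: kernel_uce_map_center.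
move=> Z f [[/seteqP[_ f1_surj] _] f1_central _].
pose D := derived_algebra (xM Z).
have [D0 DD] := (submod_closed_set _).1 (smallest_submod_closed
  [set ⁅x, y⁆ | x in [set: xM Z] & y in [set: xM Z]]).
have [||d e /= d0|h hE] := @uce_lift_hom _ _ _ (xbd \o hom1 f : {lie _ -> _}) D.
- split; first exact: smallest_submod_closed.
  by move=> x y _ _; apply: mem_set; apply: derived_lie.
- move=> x; have [m <-] := bd_surj x.
  (* The derived algebra of [xM Z] still maps onto [xM X], because [xM X] is perfect and brackets
     lift to brackets. *)
  suff [d Dd <-] : exists2 d, D d & hom1 f d = m by exists d.
  move: m; apply: (perfect_ind dM) => [|a _ _ [d Dd <-] [e De <-]|m m'].
  + by exists 0; rewrite ?linear0.
  + by exists (a *: d + e); [apply: DD|rewrite linearP].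
  + have [[d _ <-] [e _ <-]] := (f1_surj m I, f1_surj m' I).
    by exists ⁅d, e⁆; [apply: derived_lie|rewrite lie_morph].
(* [hom1 f d] has zero boundary, hence is central, so [⁅d, a⁆] lies in the kernel of [hom1 f] and is
   itself central. The derivation rule then gives [⁅d, ⁅a, b⁆⁆ = 0]. *)
- have dC a b : ⁅⁅d, a⁆, b⁆ = 0.
    apply: act_invariants_center (b); apply: f1_central.
    by rewrite /kernel /= lie_morph -xpeiffer d0 linear0l.
  move/(_ [set e | ⁅d, e⁆ = 0]); apply; split.
    apply/submod_closed_set; split=> [|a v v' /= v0 v'0].
      by rewrite /= linear0r.
    by rewrite linearPr /= v0 v'0 scaler0 addr0.
  move=> _ [a _ [b _ <-]] /=.
  by rewrite lie_derivation dC (lieC a) dC oppr0 addr0.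
(* The two maps have the same boundary, and [xbd] has central kernel, so perfectness of the source
   makes them equal. *)
have u1_fh : u1 =1 hom1 f \o h.
  apply: (perfect_hom_unique (@kernel_xbd_center _ X) dW) => w.
  by rewrite u1E -hE.
exists (id_bxmod_hom h); split; first split=> w /=; rewrite ?u1_fh ?hom_bd //.
move=> h' [h'1 _].
have hh' : h =1 hom1 h'.
  apply: (perfect_hom_unique _ dW) => [|w].
    by apply: subset_trans (@act_invariants_center _ Z); exact: f1_central.
  by rewrite -[RHS]h'1 /= u1_fh.
by split=> w //=; rewrite hh' hom_bd.
Qed.

End PerfectBraided.

(** * Products with an abelian crossed module *)

Section CentralProduct.
Variables (K : fieldType) (A : lmodType K).

(** One construction for the bracket, the action and the braiding of X x A: ignoring [A] in the
    arguments and returning zero there makes [A] a central factor. *)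
Definition prod_bilinear (U U' V : lmodType K) (b : {bilinear U -> U' -> V})
  (p : U * A) (q : U' * A) : V * A := (b p.1 q.1, 0).

Fact prod_bilinear_subproof (U U' V : lmodType K)
  (b : {bilinear U -> U' -> V}) : bilinear_for *:%R *:%R (prod_bilinear b).
Proof.
by split=> [q a p p'|p a q q']; rewrite /prod_bilinear;
  congr (_, _); rewrite /= ?linearPl ?linearPr // scaler0 addr0.
Qed.

HB.instance Definition _ (U U' V : lmodType K) (b : {bilinear U -> U' -> V}) :=
  bilinear_isBilinear.Build K (U * A)%type (U' * A)%type (V * A)%type
    *:%R *:%R (prod_bilinear b) (prod_bilinear_subproof b).

Section Lie.
Variable L : lieAlgType K.

Definition central_prod : Type := (L * A)%type.

HB.instance Definition _ := GRing.Lmodule.on central_prod.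

Definition central_prod_lie :
    {bilinear central_prod -> central_prod -> central_prod} :=
  prod_bilinear (@lie K L).

Fact central_prod_liexx p : central_prod_lie p p = 0.
Proof. by rewrite /= /prod_bilinear liexx. Qed.

Fact central_prod_jacobi p q r :
  central_prod_lie p (central_prod_lie q r)
  + central_prod_lie q (central_prod_lie r p)
  + central_prod_lie r (central_prod_lie p q) = 0.
Proof. by congr (_, _); rewrite /= ?lie_jacobi ?addr0. Qed.

HB.instance Definition _ := Lmodule_isLieAlgebra.Build K central_prod
  central_prod_liexx central_prod_jacobi.

Lemma central_prod_lieE (p q : central_prod) : ⁅p, q⁆ = (⁅p.1, q.1⁆, 0).
Proof. by []. Qed.

End Lie.
End CentralProduct.

Section CentralProductBraided.
Variables (K : fieldType) (A : lmodType K) (X : braidedCrossedModule K).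
Variable delta : {linear A -> A}.

Local Notation MA := (central_prod A (xM X)).
Local Notation NA := (central_prod A (xN X)).

Definition central_prod_fst (L : lieAlgType K) (p : central_prod A L) : L :=
  p.1.

HB.instance Definition _ (L : lieAlgType K) :=
  GRing.isLinear.Build K (central_prod A L) L *:%R (@central_prod_fst L)
    (fun _ _ _ => erefl).

HB.instance Definition _ (L : lieAlgType K) :=
  isLieMorphism.Build K (central_prod A L) L (@central_prod_fst L)
    (fun _ _ => erefl).

(** With zero bracket, action and braiding on [A], any linear [delta] is a valid boundary; the
    identity and zero are the cases applied later. *)
Definition central_prod_bd (p : MA) : NA := (xbd p.1, delta p.2).

Fact central_prod_bd_linear : linear central_prod_bd.
Proof. by move=> a p q; rewrite /central_prod_bd /= !linearP. Qed.

HB.instance Definition _ :=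
  GRing.isLinear.Build K MA NA *:%R central_prod_bd central_prod_bd_linear.

Fact central_prod_bd_lie :
  {morph central_prod_bd : p q / ⁅p, q⁆ >-> ⁅p, q⁆}.
Proof.
move=> p q; rewrite !central_prod_lieE /central_prod_bd /= lie_morph.
by rewrite linear0.
Qed.

HB.instance Definition _ :=
  isLieMorphism.Build K MA NA central_prod_bd central_prod_bd_lie.

Let actA : {bilinear NA -> MA -> MA} := @prod_bilinear K A _ _ _ (@xact K X).

Let braidA : {bilinear NA -> NA -> MA} := @prod_bilinear K A _ _ _ (@braid K X).

Let subA0 (L : lieAlgType K) (x y : L) : ((x, 0) - (y, 0) : L * A) = (x - y, 0).
Proof. by congr (_, _); rewrite /= subr0. Qed.

Let addA0 (L : lieAlgType K) (x y : L) : ((x, 0) + (y, 0) : L * A) = (x + y, 0).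
Proof. by congr (_, _); rewrite /= addr0. Qed.

Definition central_prod_xmod : crossedModule K.
Proof.
refine (@CrossedModule K MA NA actA central_prod_bd _ _ _ _).
- move=> n n' m; rewrite /= /prod_bilinear /=.
  by rewrite [RHS]subA0 xact_lie.
- move=> n m m'; rewrite /= /prod_bilinear /=.
  by rewrite [RHS]addA0 xact_der.
- move=> n m; rewrite central_prod_lieE /= /central_prod_bd /=.
  by rewrite xbd_act linear0.
- by move=> m m'; rewrite central_prod_lieE /= /prod_bilinear /= xpeiffer.
Defined.

Definition central_prod_bxmod : braidedCrossedModule K.
Proof.
refine (@BraidedCrossedModule K central_prod_xmod braidA _ _ _ _ _ _).
- move=> n n'; rewrite [RHS]central_prod_lieE /= /central_prod_bd /=.
  by rewrite bd_braid linear0.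
- by move=> m m'; rewrite [RHS]central_prod_lieE /= /prod_bilinear /= braid_bd.
- move=> m n; rewrite /= /prod_bilinear /= braid_bdl.
  by congr (_, _); rewrite /= oppr0.
- by move=> n m; rewrite /= /prod_bilinear /= braid_bdr.
- move=> x y z; rewrite /= /prod_bilinear /= braid_lier.
  by rewrite [RHS]subA0.
- move=> x y z; rewrite /= /prod_bilinear /= braid_liel.
  by rewrite [RHS]subA0.
Defined.

Definition central_prod_proj : bxmodHom central_prod_bxmod X.
Proof.
by unshelve refine (@BXModHom K central_prod_bxmod X
  (@XModHom K central_prod_xmod X (@central_prod_fst (xM X))
     (@central_prod_fst (xN X)) _ _) _).
Defined.

Lemma central_prod_proj_central :
  compatible_central_extension central_prod_proj.
Proof.
split; first split.
- by apply/seteqP; split=> // m _; exists (m, 0).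
- by apply/seteqP; split=> // n _; exists (n, 0).
- move=> m m0 n; rewrite /= /prod_bilinear /=.
  by rewrite [m.1]m0 linear0r.
- move=> n n0; split=> [m|y].
    by rewrite /= /prod_bilinear /= [n.1]n0 linear0l.
  by rewrite central_prod_lieE [n.1]n0 linear0l.
Qed.

Section Graph.
Variables (phi1 : {linear xM X -> A}) (phi2 : {linear xN X -> A}).
Hypothesis phi1_act : forall (n : xN X) (m : xM X), phi1 (xact n m) = 0.
Hypothesis phi1_braid : forall n n' : xN X, phi1 (braid n n') = 0.
Hypothesis phi2_lie : forall n n' : xN X, phi2 ⁅n, n'⁆ = 0.
Hypothesis phi_bd : forall m : xM X, delta (phi1 m) = phi2 (xbd m).

Definition graph (L : lieAlgType K) (phi : {linear L -> A}) (x : L) :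
  central_prod A L := (x, phi x).

HB.instance Definition _ (L : lieAlgType K) (phi : {linear L -> A}) :=
  GRing.isLinear.Build K L (central_prod A L) *:%R (graph phi)
    (fun a x y => congr1 (pair (a *: x + y)) (linearP phi a x y)).

Lemma graph_lie (L : lieAlgType K) (phi : {linear L -> A}) :
  (forall x y, phi ⁅x, y⁆ = 0) ->
  {morph graph phi : x y / ⁅x, y⁆ >-> ⁅x, y⁆}.
Proof. by move=> phi0 x y; rewrite central_prod_lieE /graph phi0. Qed.

Lemma phi1_lie (m m' : xM X) : phi1 ⁅m, m'⁆ = 0.
Proof. by rewrite -xpeiffer. Qed.

Definition graph1 : xM X -> MA := graph phi1.
Definition graph2 : xN X -> NA := graph phi2.

HB.instance Definition _ := GRing.Linear.on graph1.
HB.instance Definition _ := GRing.Linear.on graph2.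
HB.instance Definition _ :=
  isLieMorphism.Build K (xM X) MA graph1 (graph_lie phi1_lie).
HB.instance Definition _ :=
  isLieMorphism.Build K (xN X) NA graph2 (graph_lie phi2_lie).

(** The hypotheses make ([phi1], [phi2]) a morphism from X to the abelian module (A -> A) with
    boundary [delta]; its graph is a section of [central_prod_proj]. *)
Definition graph_bxmodHom : bxmodHom X central_prod_bxmod.
Proof.
unshelve refine (@BXModHom K X central_prod_bxmod
  (@XModHom K X central_prod_xmod graph1 graph2 _ _) _).
- by move=> n m; congr (_, _); apply: phi1_act.
- by move=> m; rewrite /= /central_prod_bd /= phi_bd.
- by move=> n n'; congr (_, _); apply: phi1_braid.
Defined.

End Graph.
End CentralProductBraided.

(* Both the graph of (phi1, phi2) and the zero section lift the universal
   extension to X x A, so they agree. *)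
Lemma universal_no_abelian_quotient (K : fieldType)
    (X U : braidedCrossedModule K) (u : bxmodHom U X) (A : lmodType K)
    (delta : {linear A -> A}) (phi1 : {linear xM X -> A})
    (phi2 : {linear xN X -> A}) :
  universal_compatible_central_extension u ->
  (forall (n : xN X) (m : xM X), phi1 (xact n m) = 0) ->
  (forall n n' : xN X, phi1 (braid n n') = 0) ->
  (forall n n' : xN X, phi2 ⁅n, n'⁆ = 0) ->
  (forall m : xM X, delta (phi1 m) = phi2 (xbd m)) ->
  phi1 =1 \0 /\ phi2 =1 \0.
Proof.
move=> [[[/seteqP[_ u1_surj] /seteqP[_ u2_surj]] _ _] u_univ].
move=> act0 braid0 lie0 bd.
have zbd m :
    delta ((\0 : {linear xM X -> A}) m) = (\0 : {linear xN X -> A}) (xbd m).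
  by rewrite /= linear0.
pose g := graph_bxmodHom act0 braid0 lie0 bd.
pose z := graph_bxmodHom (phi1 := \0) (phi2 := \0) (fun _ _ => erefl)
  (fun _ _ => erefl) (fun _ _ => erefl) zbd.
have [h [_ h_uniq]] := u_univ _ _ (central_prod_proj_central X delta).
(* Projecting either composite back to X gives [u] by computation, so [h] equals both; their second
   components are then compared. *)
have [hg1 hg2] := h_uniq (bxmod_comp g u) (conj (frefl _) (frefl _)).
have [hz1 hz2] := h_uniq (bxmod_comp z u) (conj (frefl _) (frefl _)).
split=> [m|n].
- have [w _ <-] := u1_surj m I.
  by have := etrans (esym (hg1 w)) (hz1 w) => /(congr1 snd).
- have [w _ <-] := u2_surj n I.
  by have := etrans (esym (hg2 w)) (hz2 w) => /(congr1 snd).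
Qed.

(** * Universality forces perfectness *)

Lemma universal_perfect (K : fieldType) (X U : braidedCrossedModule K)
    (u : bxmodHom U X) :
  universal_compatible_central_extension u -> perfect X.
Proof.
move=> u_univ.
have dN : derived_algebra (xN X) = [set: xN X].
  apply/seteqP; split=> // n _.
  pose dN_closed := smallest_submod_closed
    [set ⁅x, y⁆ | x in [set: xN X] & y in [set: xN X]].
  pose pi := quotmod_pi dN_closed : {linear _ -> _}.
  have pi0 x y : pi ⁅x, y⁆ = 0.
    by apply/(quotmod_pi_eq0 dN_closed); apply: derived_lie.
  (* Here A is N / [N, N]; with the identity as [delta], compatibility with boundaries forces [phi1]
     to be [pi \o xbd]. *)
  have [||//|//|_ pi_eq0] := @universal_no_abelian_quotient _ _ _ _ _ idfun
    (pi \o xbd) pi u_univ.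
  - by move=> x m; rewrite /= xbd_act pi0.
  - by move=> x y; rewrite /= bd_braid pi0.
  - exact/(quotmod_pi_eq0 dN_closed)/pi_eq0.
split=> //; apply/seteqP; split=> // m _.
have [dM_closed _] := generated_lie_subalgebra_closed
  [set xact n m | n in [set: xN X] & m in [set: xM X]].
pose pi := quotmod_pi dM_closed : {linear _ -> _}.
have pi0 (n : xN X) (x : xM X) : pi (xact n x) = 0.
  apply/(quotmod_pi_eq0 dM_closed); apply: sub_gen_smallest.
  by exists n => //; exists x.
have [//||//|//|pi_eq0 _] := @universal_no_abelian_quotient _ _ _ _ _ \0
  pi \0 u_univ.
(* Vanishing on the braiding relies on the first half: as [N, N] = N, each [y] is a boundary, and
   [braid_bdr] turns the braiding into an action. *)
- move=> x y; have [y' <-] := braided_xbd_surjective dN y.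
  by rewrite braid_bdr pi0.
- exact/(quotmod_pi_eq0 dM_closed)/pi_eq0.
Qed.

Theorem corollary3p7 (K : fieldType) (X : braidedCrossedModule K) :
  (exists (U : braidedCrossedModule K) (u : bxmodHom U X),
      universal_compatible_central_extension u)
  <-> perfect X.
Proof.
split=> [[U [u]]|]; first exact: universal_perfect.
exact: perfect_has_universal_compatible_central_extension.
Qed.
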